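(* Let $k\in\{1,2,3\}$. If $A\in C_k$ and $A\not\subseteq E_k$, then $$\bar d(A)<d(E_k)=1-\frac{\varphi(p_1p_2\cdots p_k)}{p_1p_2\cdots p_k}.$$
   Context: Let $\mathbb{Z}^{+}$ be the set of positive integers, $p_i$ the $i$th prime, and $\varphi$ Euler's totient function. $C_k$ is the family of all subsets $A\subseteq\mathbb{Z}^{+}$ that do not contain $k+1$ (distinct) pairwise coprime integers. $E_k$ is the set of positive integers divisible by at least one of $p_1,\ldots,p_k$. For $A\subseteq\mathbb{Z}^{+}$, $A(n)=A\cap\{1,\ldots,n\}$, $\bar d(A)=\limsup_{n\to\infty}|A(n)|/n$, $\underline d(A)=\liminf_{n\to\infty}|A(n)|/n$, and if these agree their common value is denoted $d(A)$. *)

(* Defs.v *)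
From mathcomp Require Export all_boot all_order all_algebra.
From mathcomp Require Export finmap.
From mathcomp Require Export all_classical all_reals all_analysis.

Set Implicit Arguments.
Unset Strict Implicit.
Unset Printing Implicit Defensive.

Import Order.TTheory GRing.Theory Num.Theory.
Local Open Scope classical_set_scope.

Fact exists_prime_gt (m : nat) : exists p, prime p && (m < p)%N.
Proof. by have [p mp pp] := prime_above m; exists p; rewrite pp mp. Qed.

Definition next_prime (m : nat) : nat := ex_minn (exists_prime_gt m).

(* Indexing starts at 1: [nth_prime 1 = 2]; [nth_prime 0 = 0] is a dummy. *)
Definition nth_prime (i : nat) : nat := iter i next_prime 0%N.

Definition primorial (k : nat) : nat :=
  (\prod_(1 <= i < k.+1) nth_prime i)%N.

Definition C (k : nat) : set (set nat) :=
  [set A | A `<=` [set a | 0 < a]%N /\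
    ~ exists s : seq nat,
        [/\ size s = k.+1, uniq s, [set` s] `<=` A & pairwise coprime s]].

Definition E (k : nat) : set nat :=
  [set n | (0 < n)%N /\ exists i : nat, (1 <= i <= k)%N /\ (nth_prime i %| n)%N].

Definition counting (A : set nat) (n : nat) : nat :=
  #|` fset_set (A `&` `[1%N, n]) |%fset.

Local Open Scope ring_scope.

(* The term of index 0 is 0 / 0 = 0, which does not affect the limits. *)
Definition relative_count (R : realType) (A : set nat) : R^nat :=
  fun n => (counting A n)%:R / n%:R.

Definition upper_density (R : realType) (A : set nat) : R :=
  limn_sup (relative_count R A).

Definition lower_density (R : realType) (A : set nat) : R :=
  limn_inf (relative_count R A).

Definition has_density (R : realType) (A : set nat) (d : R) : Prop :=
  upper_density R A = d /\ lower_density R A = d.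

(* Main.v *)
Require Import Defs.
From mathcomp Require Import zify.

Import Order.TTheory GRing.Theory Num.Theory numFieldNormedType.Exports.

(** Put P = p_1...p_k (so P = 2, 6 or 30) and cut the positive integers into
    windows [Pq, Pq + P).  If j - i > 0 has only prime factors dividing P and
    gcd(i, j, P) = 1, then Pq + i and Pq + j are coprime for every q.  The sets
    of k + 1 offsets that are pairwise coprime in this sense form a hypergraph
    on {0, ..., P-1}; the offsets missing from a window of A meet all its edges,
    and a branching search shows that phi(P) - 1 points cannot do so.  Hence A
    has at most P - phi(P) elements in each window.

    Let now a be in A but not in E_k, i.e. coprime to P.  In the windows with
    a | Pq + 2, the number Pq + j is coprime to a as soon as j - 2 <> 0 has only
    prime factors dividing P, so k such offsets that are pairwise coprime also
    form an edge (complete it with a).  With these edges phi(P) points no longer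
    suffice, so such a window, one out of every a, loses one more element of A. *)

(** * Search for small hitting sets *)

(* Branches on whether the hitting set contains [v].  Each step removes [v] from
   all edges, so fuel exceeding the number of vertices is enough. *)
Fixpoint unhittable (fuel n : nat) (es : seq (seq nat)) : bool :=
  if fuel is fuel'.+1 then
    match es with
    | [::] => false
    | [::] :: _ => true
    | (v :: _) :: _ =>
        (n == 0) ||
        (unhittable fuel' n.-1 [seq e <- es | v \notin e] &&
         unhittable fuel' n [seq [seq w <- e | w != v] | e <- es])
    end
  else false.

(** If [v] is in [R], then [R] without [v] still meets all edges that avoid [v]; otherwise [R] meets
    every edge at a vertex other than [v]. Exhausted fuel answers [false], so [true] can be trusted
    for any fuel. *)
Lemma unhittableP fuel n (es : seq (seq nat)) (R : seq nat) :
  unhittable fuel n es -> (forall e, e \in es -> has [in R] e) -> n < size R.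
Proof.
elim: fuel n es R => [//|fuel IH] n es R /=.
case Ees: es => [//|[|v e] es'].
  by move=> _ /(_ [::] (mem_head _ _)).
rewrite -{1 2}Ees => /orP[/eqP -> hit|/andP[H1 H2] hit].
  by have := hit _ (mem_head _ _); case: (R) => //; rewrite has_pred0.
rewrite -Ees in hit.
have [vR|vR] := boolP (v \in R).
  have := IH _ _ (rem v R) H1; rewrite size_rem // => h.
  suff: n.-1 < (size R).-1 by lia.
  apply: h => d; rewrite mem_filter => /andP[vd /hit /hasP[w wd wR]].
  have wv : w != v by apply: contraNneq vd => <-.
  apply/hasP; exists w => //; move: wR => /=.
  by rewrite (perm_mem (perm_to_rem vR)) inE (negbTE wv).
apply: (IH _ _ _ H2) => _ /mapP[d /hit /hasP[w wd wR] ->].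
apply/hasP; exists w => //; rewrite mem_filter wd andbT.
by apply: contraNneq vR => <-.
Qed.

(** The offsets where [f] fails meet every edge, so there are more than [n] of them. *)
Lemma count_unhittable fuel n P (es : seq (seq nat)) (f : pred nat) :
  unhittable fuel n es ->
  (forall e, e \in es -> {subset e <= iota 0 P} /\ ~~ all f e) ->
  n + \sum_(0 <= j < P) f j < P.
Proof.
move=> un hes; have -> : \sum_(0 <= j < P) f j = count f (iota 0 P).
  rewrite /index_iota subn0 -sum1_count [RHS]big_mkcond.
  by apply: eq_bigr => i _; case: (f i).
have cp : count f (iota 0 P) + count (fun j => ~~ f j) (iota 0 P) = P.
  by rewrite -[RHS](size_iota 0) -(count_predC f).
have := unhittableP fuel n es [seq j <- iota 0 P | ~~ f j] un; rewrite size_filter.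
suff hit e : e \in es -> has [in [seq j <- iota 0 P | ~~ f j]] e.
  by move=> /(_ hit); lia.
move=> /hes[esub /allPn[j je fj]]; apply/hasP; exists j => //.
by rewrite /= mem_filter fj esub.
Qed.

(** * Pairwise coprime offsets *)

Fixpoint cliques (r : rel nat) (n : nat) (s : seq nat) : seq (seq nat) :=
  if n is n'.+1 then
    [seq v :: c | v <- s, c <- cliques r n' [seq w <- s | r v w]]
  else [:: [::]].

Lemma mem_cliques (r : rel nat) n s c : c \in cliques r n s ->
  [/\ size c = n, {subset c <= s} & pairwise r c].
Proof.
elim: n s c => [|n IH] s c /=; first by rewrite inE => /eqP ->.
case/allpairsPdep=> v [d [vs /IH[<- dsub rd] ->]]; split=> //=.
  move=> w; rewrite inE => /predU1P[->//|/dsub].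
  by rewrite mem_filter => /andP[].
by rewrite rd andbT; apply/allP => w /dsub; rewrite mem_filter => /andP[].
Qed.

(** The condition [i < j] orients the relation, so that [cliques] lists each set of offsets only
    once, in increasing order. *)
Definition surely_coprime (P i j : nat) : bool :=
  [&& i < j, \pi(P).-nat (j - i) & coprime (gcdn i j) P].

Lemma coprime_no_prime m n : (0 < m) || (0 < n) ->
  (forall p, prime p -> p %| m -> p %| n -> False) -> coprime m n.
Proof.
rewrite -gcdn_gt0 => mn0 np; rewrite /coprime.
have [gt1|] := ltnP 1 (gcdn m n); last by lia.
have := pdiv_dvd (gcdn m n); rewrite dvdn_gcd => /andP[h1 h2].
by case: (np _ (pdiv_prime gt1) h1 h2).
Qed.

Lemma pnat_pi_dvd P d p : \pi(P).-nat d -> prime p -> p %| d -> p %| P.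
Proof.
move=> /andP[d0 /allP h] pp pd.
have /h : p \in primes d by rewrite mem_primes pp d0.
by rewrite /= mem_primes => /and3P[].
Qed.

(** A common prime divides [j - i], hence [P], hence both [i] and [j], against the gcd condition. *)
Lemma surely_coprimeP P q i j :
  surely_coprime P i j -> coprime (P * q + i) (P * q + j).
Proof.
move=> /and3P[ij smooth cop]; apply: coprime_no_prime; first by lia.
move=> p pp pi pj.
have pd : p %| j - i by have := dvdn_sub pj pi; rewrite subnDl.
have pP := pnat_pi_dvd _ _ _ smooth pp pd.
have : p %| gcdn (gcdn i j) P.
  have pPq : p %| P * q by rewrite dvdn_mulr.
  by rewrite !dvdn_gcd pP -(dvdn_addr _ pPq) pi -(dvdn_addr _ pPq) pj.
by rewrite (eqP cop) dvdn1 => /eqP p1; rewrite p1 in pp.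
Qed.

(** A prime dividing [a] and [P * q + j] also divides [P * q + e], hence |j - e|, hence [P], which
    is coprime to [a]. *)
Lemma coprime_near_multiple P q a e j : coprime a P -> a %| P * q + e ->
  \pi(P).-nat ((j - e) + (e - j)) -> coprime a (P * q + j).
Proof.
move=> cop ae smooth; have je : j <> e.
  by move=> je; rewrite je subnn in smooth.
apply: coprime_no_prime; first by lia.
move=> p pp pa pj; have pe := dvdn_trans pa ae.
have pd : p %| (j - e) + (e - j).
  have := dvdn_add (dvdn_sub pj pe) (dvdn_sub pe pj).
  by rewrite !subnDl.
have pP := pnat_pi_dvd _ _ _ smooth pp pd.
have : p %| gcdn a P by rewrite dvdn_gcd pa.
by rewrite (eqP cop) dvdn1 => /eqP p1; rewrite p1 in pp.
Qed.

Definition coprime_sets (k P : nat) : seq (seq nat) :=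
  cliques (surely_coprime P) k.+1 (iota 0 P).

(** With truncated subtraction, [(j - e) + (e - j)] is |j - e|; the offset [e] itself is excluded
    because 0 is not a [pnat]. *)
Definition coprime_sets_near (k P e : nat) : seq (seq nat) :=
  cliques (surely_coprime P) k
    [seq j <- iota 0 P | \pi(P).-nat ((j - e) + (e - j))].

Lemma pairwise_shift P q s : pairwise (surely_coprime P) s ->
  let s' := [seq P * q + j | j <- s] in uniq s' /\ pairwise coprime s'.
Proof.
move=> ps s'; split.
  rewrite map_inj_uniq; last by move=> x y; lia.
  apply: (@sorted_uniq _ ltn ltn_trans ltnn).
  rewrite sorted_pairwise; last exact: ltn_trans.
  by apply: sub_pairwise ps => i j /and3P[].
by rewrite pairwise_map; apply: sub_pairwise ps => i j; apply: surely_coprimeP.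
Qed.

(** * Bounds for a single window *)

Lemma window_bound fuel n k P (A : set nat) q : C k A ->
  unhittable fuel n (coprime_sets k P) ->
  n + \sum_(0 <= j < P) `[< A (P * q + j)%N >] < P.
Proof.
move=> [_ noA] un; apply: (count_unhittable _ _ _ _ (fun j => `[< A (P * q + j)%N >]) un).
move=> e /mem_cliques[size_e sub_e pe]; split=> //.
apply/negP => /allP eA; apply: noA; exists [seq P * q + j | j <- e].
have [u p] := pairwise_shift P q _ pe.
split=> //; first by rewrite size_map.
by move=> x /= /mapP[j /eA /asboolP Aj ->].
Qed.

(** The bound [a < P * q] puts [a] outside the window, so that completing an edge of [k] offsets
    with [a] gives [k + 1] distinct integers. *)
Lemma window_bound_near fuel n k P e (A : set nat) a q : C k A ->
  A a -> coprime a P -> a < P * q -> a %| P * q + e ->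
  unhittable fuel n (coprime_sets_near k P e ++ coprime_sets k P) ->
  n + \sum_(0 <= j < P) `[< A (P * q + j)%N >] < P.
Proof.
move=> [_ noA] Aa cop aq ae un.
apply: (count_unhittable _ _ _ _ (fun j => `[< A (P * q + j)%N >]) un).
move=> d; rewrite mem_cat => /orP[]/mem_cliques[size_d sub_d pd]; split=> //;
  have [u p] := pairwise_shift P q _ pd.
- by move=> j /sub_d; rewrite mem_filter => /andP[].
- apply/negP => /allP dA; apply: noA; exists (a :: [seq P * q + j | j <- d]).
  split=> /=; first by rewrite size_map size_d.
  + by rewrite u andbT; apply/mapP => -[j _]; lia.
  + by move=> x /=; rewrite inE => /predU1P[->//|/mapP[j /dA /asboolP Aj ->]].
  + rewrite p andbT; apply/allP => _ /mapP[j /sub_d + ->].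
    by rewrite mem_filter => /andP[sm _]; apply: coprime_near_multiple sm.
- apply/negP => /allP dA; apply: noA; exists [seq P * q + j | j <- d].
  split=> //; first by rewrite size_map.
  by move=> x /= /mapP[j /dA /asboolP Aj ->].
Qed.

(** * From windows to counting functions *)

Lemma countingE (A : set nat) n : (A `<=` [set a | 0 < a])%classic ->
  counting A n = \sum_(0 <= x < n.+1) `[< A x >].
Proof.
move=> Apos; rewrite /counting.
have -> : \sum_(0 <= x < n.+1) `[< A x >] = size [seq x <- iota 0 n.+1 | `[< A x >]].
  rewrite size_filter -sum1_count [RHS]big_mkcond /index_iota subn0 /=.
  by apply: eq_bigr => i _; case: `[< _ >].
apply/perm_size/uniq_perm; rewrite ?filter_uniq ?iota_uniq ?fset_uniq //.
have fin : finite_set (A `&` `[1, n])%classic.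
  apply: (@sub_finite_set _ _ `I_n.+1); last exact: finite_II.
  by move=> x [_] /=; rewrite in_itv /= !leEnat => /andP[].
move=> x; rewrite in_fset_set // mem_filter mem_iota /= add0n ltnS.
apply/idP/andP => [/set_mem[Ax] /=|[/asboolP Ax xn]].
  by rewrite in_itv /= !leEnat => /andP[_ ->]; split=> //; apply/asboolP.
by apply/mem_set; split=> //=; rewrite in_itv /= !leEnat xn andbT; apply: Apos.
Qed.

Lemma sum_windows (F : nat -> nat) L q :
  \sum_(0 <= x < L * q) F x = \sum_(0 <= r < q) \sum_(0 <= j < L) F (L * r + j).
Proof.
elim: q => [|q IH]; first by rewrite muln0 !big_nil.
rewrite big_nat_recr //= -IH mulnS addnC.
rewrite (@big_cat_nat _ _ _ (L * q)) ?leq_addr //=; congr (_ + _).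
by rewrite -{1}[L * q]add0n big_addn addKn; apply: eq_bigr => j _; rewrite addnC.
Qed.

Lemma sum_nat_bool_le (f : nat -> bool) m n : \sum_(m <= x < n) f x <= n - m.
Proof. by rewrite -[n - m]muln1 -sum_nat_const_nat leq_sum // => i _; case: (f i). Qed.

Lemma counting_upper (A : set nat) L B q0 :
  (A `<=` [set a | 0 < a])%classic -> 0 < L ->
  (forall q, q0 <= q -> \sum_(0 <= j < L) `[< A (L * q + j)%N >] <= B) ->
  exists K, forall n, counting A n * L <= B * n + K.
Proof.
(* [B * L] pays for rounding [n] up to a full window, and [L * q0 * L] for the windows before [q0],
   bounded trivially. *)
move=> Apos L0 hB; exists (B * L + L * q0 * L) => n; rewrite countingE //.
pose F x : nat := `[< A x >].
have S q : \sum_(0 <= x < L * q) F x <= B * q + L * q0.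
  elim: q => [|q IH]; first by rewrite muln0 big_nil.
  have [qq|qq] := ltnP q q0.
    by have := sum_nat_bool_le (fun x => `[< A x >]) 0 (L * q.+1); rewrite /F; nia.
  rewrite sum_windows big_nat_recr //= -sum_windows.
  by have := hB q qq; rewrite /F in IH *; lia.
have := S (n %/ L).+1; have := ltn_ceil n L0; have := leq_trunc_div n L => h1 h2.
rewrite (@big_cat_nat _ _ _ n.+1) //=; last by rewrite mulnC.
rewrite /F; nia.
Qed.

Lemma counting_lower (A : set nat) L B q0 :
  (A `<=` [set a | 0 < a])%classic -> 0 < L ->
  (forall q, q0 <= q -> B <= \sum_(0 <= j < L) `[< A (L * q + j)%N >]) ->
  exists K, forall n, B * n <= counting A n * L + K.
Proof.
(* Here [B * L] pays for dropping the last partial window, and [B * q0 * L] for the early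
   windows. *)
move=> Apos L0 hB; exists (B * L + B * q0 * L) => n; rewrite countingE //.
pose F x : nat := `[< A x >].
have S q : B * q <= \sum_(0 <= x < L * q) F x + B * q0.
  elim: q => [|q IH]; first by rewrite muln0.
  have [qq|qq] := ltnP q q0; first by nia.
  rewrite sum_windows big_nat_recr //= -sum_windows.
  by have := hB q qq; rewrite /F in IH *; lia.
have := S (n %/ L); have := ltn_ceil n L0; have := leq_trunc_div n L => h1 h2.
rewrite (@big_cat_nat _ _ _ (L * (n %/ L)) 0 n.+1) //=; last by rewrite mulnC; lia.
rewrite /F; nia.
Qed.

(** * The first primes and membership in [E k] *)

Lemma next_primeP m : [/\ prime (next_prime m), m < next_prime m
  & forall q, prime q -> m < q -> next_prime m <= q].
Proof.
rewrite /next_prime; case: ex_minnP => p /andP[pp mp] pmin; split=> // q pq mq.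
by apply: pmin; rewrite pq.
Qed.

Lemma nth_prime_prime i : 0 < i -> prime (nth_prime i).
Proof. by case: i => // i _; case: (next_primeP (nth_prime i)). Qed.

Lemma next_prime_eq m p : prime p -> m < p ->
  (forall q, m < q < p -> ~~ prime q) -> next_prime m = p.
Proof.
move=> pp mp gap; have [pn mn nmin] := next_primeP m.
apply/eqP; rewrite eqn_leq nmin //= leqNgt; apply/negP => np.
by have := gap (next_prime m); rewrite mn np pn => /(_ isT).
Qed.

Lemma nth_prime1 : nth_prime 1 = 2.
Proof. by apply: next_prime_eq => // -[|[|]]. Qed.

Lemma nth_prime2 : nth_prime 2 = 3.
Proof.
rewrite -[LHS]/(next_prime (nth_prime 1)) nth_prime1.
by apply: next_prime_eq => // -[|[|[|]]].
Qed.

Lemma nth_prime3 : nth_prime 3 = 5.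
Proof.
rewrite -[LHS]/(next_prime (nth_prime 2)) nth_prime2.
by apply: next_prime_eq => // -[|[|[|[|[|]]]]].
Qed.

Lemma primorialS k : primorial k.+1 = primorial k * nth_prime k.+1.
Proof. by rewrite /primorial big_nat_recr. Qed.

Lemma primorial_gt0 k : 0 < primorial k.
Proof.
elim: k => [|k IH]; first by rewrite /primorial big_geq.
by rewrite primorialS muln_gt0 IH prime_gt0 ?nth_prime_prime.
Qed.

(** For positive [x] this makes membership depend only on the residue of [x] modulo
    [primorial k]. *)
Lemma E_coprime k x : E k x <-> 0 < x /\ ~~ coprime (primorial k) x.
Proof.
elim: k => [|k IH].
  rewrite /primorial big_geq // coprime1n; split=> -[x0] //.
  by case=> i [ik _]; lia.
rewrite primorialS coprimeMl negb_and [coprime (nth_prime _) _]prime_coprime.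
  2: exact: nth_prime_prime.
rewrite negbK.
split=> [[x0 [i [ik ix]]]|[x0 /orP[nc|dv]]].
- split=> //; have [ki|ik'] := ltnP k i; last first.
    apply/orP; left; apply: (proj2 (proj1 IH _)); split=> //.
    by exists i; split=> //; lia.
  by apply/orP; right; have <- : i = k.+1 by lia.
- have [_ [i [ik ix]]] := proj2 IH (conj x0 nc).
  by split=> //; exists i; split=> //; lia.
- by split=> //; exists k.+1; rewrite leqnn.
Qed.

(** * From counting functions to densities *)

Local Open Scope classical_set_scope.
Local Open Scope ring_scope.

Lemma counting_le (A : set nat) n : (counting A n <= n)%N.
Proof.
rewrite /counting.
have -> : fset_set (A `&` `[1%N, n]) = fset_set ((A `&` [set a | 0 < a]%N) `&` `[1%N, n]).
  congr fset_set; apply/seteqP; split=> x; last by case=> -[].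
  by case=> Ax xn; split=> //; split=> //; move: xn; rewrite /= in_itv /= => /andP[].
rewrite -/(counting _ _) countingE; last by move=> x [].
rewrite big_nat_recl // asboolF ?add0n; last by case.
have := sum_nat_bool_le (fun x => `[< (A `&` [set a | 0 < a]%N) x.+1 >]) 0 n.
by rewrite subn0.
Qed.

Lemma relative_count_ge0 (R : realType) A n : 0 <= relative_count R A n.
Proof. by rewrite /relative_count divr_ge0. Qed.

Lemma relative_count_le1 (R : realType) A n : relative_count R A n <= 1.
Proof.
rewrite /relative_count; case: n => [|n]; first by rewrite invr0 mulr0.
by rewrite ler_pdivrMr ?ltr0n // mul1r ler_nat counting_le.
Qed.

Lemma cvg_density_error (R : realType) (d c : R) : 
  (fun n : nat => d + c * n%:R^-1) @ \oo --> d.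
Proof.
rewrite -[X in _ --> X]addr0; apply: cvgD; first exact: cvg_cst.
rewrite -[X in _ --> X](mulr0 c); apply: cvgMr.
apply/gtr0_cvgV0; last exact: cvgr_idn.
by exists 1%N => // n /= n0; rewrite ltr0n.
Qed.

Lemma relative_count_upper (R : realType) A L B K n : (0 < L)%N ->
  (counting A n * L <= B * n + K)%N ->
  relative_count R A n <= B%:R / L%:R + K%:R / L%:R * n%:R^-1.
Proof.
move=> L0 h; case: n h => [|n] h.
  rewrite /relative_count invr0 !mulr0 addr0 divr_ge0 //.
have n0 : (0 : R) < n.+1%:R by rewrite ltr0n.
have L0' : (0 : R) < L%:R by rewrite ltr0n.
rewrite /relative_count ler_pdivrMr // mulrDl mulfVK ?gt_eqF //.
rewrite -(ler_pM2r L0') !mulrDl mulrAC !mulfVK ?gt_eqF //.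
by rewrite -!natrM -natrD ler_nat.
Qed.

(** At [n = 0] the claim would read [B / L <= 0], hence the restriction to positive [n]. *)
Lemma relative_count_lower (R : realType) A L B K n : (0 < L)%N -> (0 < n)%N ->
  (B * n <= counting A n * L + K)%N ->
  B%:R / L%:R - K%:R / L%:R * n%:R^-1 <= relative_count R A n.
Proof.
move=> L0 n_gt0 h.
have n0 : (0 : R) < n%:R by rewrite ltr0n.
have L0' : (0 : R) < L%:R by rewrite ltr0n.
rewrite /relative_count ler_pdivlMr // mulrBl mulfVK ?gt_eqF //.
rewrite -(ler_pM2r L0') !mulrBl mulrAC !mulfVK ?gt_eqF //.
by rewrite lerBlDr -!natrM -natrD ler_nat.
Qed.

(** The ratios are dominated termwise by a convergent sequence [v]; comparing suprema of tails and
    passing to the limit gives the bound. *)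
Lemma upper_density_le (R : realType) A L B K : (0 < L)%N ->
  (forall n, counting A n * L <= B * n + K)%N ->
  upper_density R A <= B%:R / L%:R.
Proof.
move=> L0 h; pose v n : R := B%:R / L%:R + K%:R / L%:R * n%:R^-1.
have vl : v @ \oo --> (B%:R / L%:R : R) := cvg_density_error R _ _.
have sv : sups v @ \oo --> (B%:R / L%:R : R) := cvg_sups vl.
have u1 : has_ubound (range (relative_count R A)).
  by exists 1 => _ [n _ <-]; apply: relative_count_le1.
have u0 : has_lbound (range (relative_count R A)).
  by exists 0 => _ [n _ <-]; apply: relative_count_ge0.
rewrite /upper_density /limn_sup -(cvg_lim _ sv) //.
apply: ler_lim.
- by apply/cvg_ex; eexists; apply: cvg_sups_inf.
- by apply/cvg_ex; eexists; exact: sv.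
- apply: nearW => n; apply: sup_le.
  + move=> _ [m nm <-]; exists (v m); split; first by exists m.
    by apply: relative_count_upper.
  + by exists (relative_count R A n); exists n => /=.
  + split; first by exists (v n); exists n => /=.
    exists (B%:R / L%:R + K%:R / L%:R) => _ [m _ <-].
    rewrite /v lerD2l; case: m => [|m]; first by rewrite invr0 mulr0 divr_ge0.
    by rewrite ler_piMr ?divr_ge0 // invf_le1 ?ltr0n // ler1n.
Qed.

Lemma has_density_periodic (R : realType) A L B q0 :
  A `<=` [set a | 0 < a]%N -> (0 < L)%N ->
  (forall q, (q0 <= q)%N -> (\sum_(0 <= j < L) `[< A (L * q + j)%N >])%N = B) ->
  has_density A (B%:R / L%:R : R).
Proof.
move=> Apos L0 h.
have [K1 hK1] := counting_upper A L B q0 Apos L0 (fun q qq => eq_leq (h q qq)).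
have [K2 hK2] := counting_lower A L B q0 Apos L0 (fun q qq => eq_leq (esym (h q qq))).
rewrite /has_density /upper_density /lower_density.
suff /cvg_limn_inf_sup[-> ->] : relative_count R A @ \oo --> (B%:R / L%:R : R) by [].
have lo := cvg_density_error R (B%:R / L%:R) (- (K2%:R / L%:R)).
apply: (squeeze_cvgr _ lo (cvg_density_error R _ (K1%:R / L%:R))).
exists 1%N => // n /= n0; rewrite mulNr.
by rewrite relative_count_upper // relative_count_lower.
Qed.

(** * The density of [E k] *)

Lemma sum_bool_addC (f : nat -> bool) n :
  (\sum_(0 <= j < n) ~~ f j + \sum_(0 <= j < n) f j = n)%N.
Proof.
rewrite -big_split /= -[RHS]subn0 -[RHS]muln1 -sum_nat_const_nat.
by apply: eq_bigr => j _; case: (f j).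
Qed.

Lemma has_density_E (R : realType) k :
  has_density (E k) (1 - (totient (primorial k))%:R / (primorial k)%:R : R).
Proof.
set P := primorial k; have P0 : (0 < P)%N := primorial_gt0 k.
have P0' : (P%:R : R) != 0 by rewrite pnatr_eq0 -lt0n.
have tP : (totient P <= P)%N.
  by rewrite totient_count_coprime; have := sum_nat_bool_le (coprime P) 0 P; rewrite subn0.
have -> : 1 - (totient P)%:R / P%:R = (P - totient P)%:R / P%:R :> R.
  by rewrite natrB // mulrBl divff.
(* Counting starts at window 1, since window 0 contains 0, which is never in [E k]. *)
apply: (@has_density_periodic R _ _ _ 1) => // [x []//|q q0].
apply/eqP; rewrite -(eqn_add2r (totient P)) subnK // totient_count_coprime.
rewrite -[X in _ == X](sum_bool_addC (coprime P)) eqn_add2r; apply/eqP.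
apply: eq_bigr => j _; congr nat_of_bool.
have <- : coprime P (P * q + j) = coprime P j by rewrite /coprime mulnC gcdnMDl.
apply/asboolP/idP => [/E_coprime[_ //]|nc].
by apply/E_coprime; split=> //; nia.
Qed.

(** * The strict inequality *)

Lemma exists_window_near a P e : (0 < a)%N -> coprime a P ->
  exists2 r, (r < a)%N & (a %| P * r + e)%N.
Proof.
(* Bezout gives [u] with [a] dividing [1 + u * P]; then [r = e * u] works, as
   [P * r + e = (1 + u * P) * e], and [r] may be reduced modulo [a]. *)
move=> a0 cop; have [u _] := Bezoutr P a0; rewrite gcdnC (eqP cop) => au.
exists (e * u %% a)%N; first by rewrite ltn_mod.
rewrite -(dvdn_addl _ (dvdn_mull (P * (e * u %/ a)) (dvdnn a))).
have -> : (P * (e * u %% a) + e + P * (e * u %/ a) * a = (1 + u * P) * e)%N.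
  by have := divn_eq (e * u) a; nia.
by rewrite dvdn_mulr.
Qed.

(** Group [a] consecutive windows into blocks of length [P * a]. Each block contains a window that
    loses one extra element, so the density is at most [1 - m.+1 / P - 1 / (P * a)]. *)
Lemma upper_density_lt (R : realType) fuel m k P e (A : set nat) a :
  C k A -> A a -> coprime a P ->
  unhittable fuel m (coprime_sets k P) ->
  unhittable fuel m.+1 (coprime_sets_near k P e ++ coprime_sets k P) ->
  upper_density R A < 1 - m.+1%:R / P%:R.
Proof.
move=> CA Aa cop un un'; have Apos : A `<=` [set a | 0 < a]%N by case: CA.
have a0 : (0 < a)%N := Apos _ Aa.
pose W q := (\sum_(0 <= j < P) `[< A (P * q + j)%N >])%N.
have base q : (m + W q < P)%N := window_bound _ _ _ _ _ q CA un.
have P0 : (0 < P)%N by have := base 0%N; lia.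
have [r0 r0a ar0] := exists_window_near a P e a0 cop.
(* [2 <= q] places the window beyond [a]. *)
have near q : (2 <= q)%N -> (m.+1 + W (a * q + r0) < P)%N.
  move=> q2; apply: (window_bound_near _ _ _ _ _ _ _ _ CA Aa cop _ _ un').
    by apply: leq_trans (leq_pmull _ P0); nia.
  by rewrite mulnDr -addnA dvdn_addr // mulnCA dvdn_mulr.
have L0 : (0 < P * a)%N by rewrite muln_gt0 P0.
have super q : (2 <= q)%N ->
    (\sum_(0 <= j < P * a) `[< A (P * a * q + j)%N >] <= a * (P - m.+1) - 1)%N.
  move=> q2; rewrite (sum_windows (fun x => `[< A (P * a * q + x)%N >])).
  have -> : (\sum_(0 <= r < a) \sum_(0 <= j < P) `[< A (P * a * q + (P * r + j))%N >]
             = \sum_(r < a) W (a * q + r))%N.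
    rewrite big_mkord; apply: eq_bigr => r _; apply: eq_bigr => j _.
    by rewrite mulnDr mulnA addnA.
  rewrite (bigD1 (Ordinal r0a)) //=.
  have : (\sum_(r < a | r != Ordinal r0a) W (a * q + r) <= a.-1 * (P - m.+1))%N.
    rewrite -[X in (X.-1 * _)%N]card_ord -(cardC1 (Ordinal r0a)) -sum_nat_const.
    by apply: leq_sum => r _; have := base (a * q + r)%N; lia.
  have -> : (a * (P - m.+1) = (P - m.+1) + a.-1 * (P - m.+1))%N by rewrite -mulSn prednK.
  by have := near q q2; set S := bigop _ _ _; set T := (a.-1 * _)%N; lia.
have [K hK] := counting_upper A (P * a) _ 2 Apos L0 super.
apply: (le_lt_trans (upper_density_le R _ _ _ _ L0 hK)).
(* This makes [a * (P - m.+1)] positive, so the truncated [- 1] in the block bound really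
   subtracts. *)
have mP : (m.+2 <= P)%N by have := near 2%N isT; lia.
have P0' : (0 : R) < P%:R by rewrite ltr0n.
have L0' : (0 : R) < (P * a)%:R by rewrite ltr0n.
rewrite ltr_pdivrMr // mulrBl mul1r natrM mulrA mulfVK ?gt_eqF //.
rewrite -!natrM ltrBrDr -natrD ltr_nat.
by nia.
Qed.

Theorem corollary2 (R : realType) (k : nat) (A : set nat) :
  (1 <= k <= 3)%N -> C k A -> ~ (A `<=` E k) ->
  exists d : R,
    [/\ has_density (E k) d,
        upper_density R A < d
      & d = 1 - (totient (primorial k))%:R / (primorial k)%:R].
Proof.
move=> k13 CA /existsNP[a /not_implyP[Aa nEa]].
exists (1 - (totient (primorial k))%:R / (primorial k)%:R); split=> //.
  exact: has_density_E.
have cop : coprime a (primorial k).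
  rewrite coprime_sym; apply/negPn/negP => nc; apply: nEa.
  by apply/E_coprime; split=> //; case: CA => /(_ _ Aa).
have primorial1 : primorial 1 = 2 by rewrite /primorial big_nat1 nth_prime1.
have primorial2 : primorial 2 = 6 by rewrite primorialS primorial1 nth_prime2.
have primorial3 : primorial 3 = 30 by rewrite primorialS primorial2 nth_prime3.
(* The offset [e = 2] is one for which the search succeeds for all three [P];
   the more natural [e = 0] fails for [P = 6] and [P = 30]. *)
case: k k13 CA nEa cop => [|[|[|[|//]]]] // _ CA _;
  rewrite ?primorial1 ?primorial2 ?primorial3 => cop.
(* In each case the fuel is [P + 1] and [m] is [totient P - 1]; both searches are run by
   computation. *)
- have -> : totient 2 = 1%N by vm_compute.
  by apply: (upper_density_lt R 3 0 _ _ 2 _ _ CA Aa cop); vm_compute.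
- have -> : totient 6 = 2%N by vm_compute.
  by apply: (upper_density_lt R 7 1 _ _ 2 _ _ CA Aa cop); vm_compute.
- have -> : totient 30 = 8%N by vm_compute.
  by apply: (upper_density_lt R 31 7 _ _ 2 _ _ CA Aa cop); vm_compute.
Qed.
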